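(* Let $G$ be a finite simple $3$-connected edge-pancyclic graph of order $n$. Then $e(G)\ge 2n-2$, and equality holds if and only if $G$ is isomorphic to the wheel $W_n=K_1\vee C_{n-1}$.
   Context: A $k$-cycle is a cycle of length $k$. A graph $G$ of order $n$ is edge-pancyclic if for every integer $k$ with $3\le k\le n$, every edge of $G$ lies in a $k$-cycle. $e(G)$ is the number of edges. $W_n$ is the graph obtained from a cycle on $n-1$ vertices by adding a new vertex adjacent to all of them. *)

(* Defs.v *)
(* A finite simple graph is a finType T with a symmetric,
   irreflexive adjacency relation e : rel T. *)
From mathcomp Require Import all_boot.
Set Implicit Arguments. Unset Strict Implicit. Unset Printing Implicit Defensive.

Section Graphs.
Variable T : finType.
Variable e : rel T.

Definition n_edges : nat :=
  #|[set E : {set T} | [exists x, exists y, e x y && (E == [set x; y])]]|.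

Definition del_rel (S : {set T}) : rel T :=
  [rel u v | [&& e u v, u \notin S & v \notin S]].

Definition connected_rel (r : rel T) (A : {set T}) : Prop :=
  forall x y, x \in A -> y \in A -> connect r x y.

Definition k_connected (k : nat) : Prop :=
  k < #|T| /\
  forall S : {set T}, #|S| < k -> connected_rel (del_rel S) (~: S).

Definition is_k_cycle (k : nat) (s : seq T) : bool :=
  [&& 3 <= k, size s == k, uniq s & cycle e s].

Definition edge_on_cycle (x y : T) (s : seq T) : bool :=
  ((x \in s) && (next s x == y)) || ((y \in s) && (next s y == x)).

Definition edge_pancyclic : Prop :=
  forall k, 3 <= k <= #|T| ->
  forall x y, e x y -> exists s, is_k_cycle k s && edge_on_cycle x y s.

End Graphs.

(* wheel W_n on vertex set 'I_n: vertex 0 is the hub, vertices 1..n-1 form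
   the cycle C_{n-1} with i ~ i+1 (indices of the rim taken mod n-1) *)
Definition wheel (n : nat) : rel 'I_n :=
  fun (i j : 'I_n) => (i != j) &&
    (((i == 0 :> nat) && (j != 0 :> nat)) ||
     ((j == 0 :> nat) && (i != 0 :> nat)) ||
     [&& (i != 0 :> nat), (j != 0 :> nat) &
        ((i.-1.+1 %% n.-1 == j.-1) || (j.-1.+1 %% n.-1 == i.-1))]).

Definition isomorphic (T1 T2 : finType) (e1 : rel T1) (e2 : rel T2) : Prop :=
  exists f : T1 -> T2, bijective f /\ forall x y, e2 (f x) (f y) = e1 x y.
Arguments wheel n : clear implicits.

(* Main.v *)
(* Only triangles are needed from pancyclicity. Call two edges equivalent if they
   are linked by a chain of edges in which neighbours share a triangle, and grow an
   equivalence class from a single edge, one triangle at a time: each new vertex brings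
   two new edges, so a class on m vertices has at least 2m - 3 edges.

   If there are several classes, each has at least three vertices shared with other
   classes, since otherwise the shared vertices would separate it from the rest.
   Counting 1 for every shared and 2 for every unshared incidence of a vertex with
   a class, the class has at least as many edges as its total weight, and every vertex
   has weight at least 2; so there are at least 2n edges.

   If there is one class, 2n - 3 edges means that the graph is a 2-tree, and
   2n - 2 edges means that it has a vertex of degree at most 2 or is a 2-tree plus one
   edge uw, where u and w have a common neighbour x. Minimum degree 3 leaves only the
   last case, and then all vertices of degree 2 of the 2-tree lie in {u, w}. Such
   a 2-tree is a fan with hub x and a path from u to w, which uw closes to a wheel. *)
Require Import Defs.
From mathcomp Require Import all_boot zify.
Set Implicit Arguments. Unset Strict Implicit. Unset Printing Implicit Defensive.

(** * 2-trees as edge sets, and their vertices of degree at most two *)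

Section TwoTrees.
Variable T : finType.
Implicit Types (a b c v w x y z : T) (E : {set T}) (F : {set {set T}}) (s : seq T).

Lemma set2_eq a b c d :
  [set a; b] = [set c; d] -> (a = c /\ b = d) \/ (a = d /\ b = c).
Proof.
move=> eqS.
have: a \in [set c; d] by rewrite -eqS set21.
have: b \in [set c; d] by rewrite -eqS set22.
have: c \in [set a; b] by rewrite eqS set21.
have: d \in [set a; b] by rewrite eqS set22.
by rewrite !inE => /orP[]/eqP da /orP[]/eqP ca /orP[]/eqP bc /orP[]/eqP ac; subst; auto.
Qed.

(** At most two edges of [F] meet [v]. The two ends may coincide, and a vertex outside [cover F]
    qualifies vacuously. *)
Definition low_degree F v :=
  exists a b, forall E, E \in F -> v \in E -> E = [set v; a] \/ E = [set v; b].

Definition add_triangle F a b z := [set z; a] |: ([set z; b] |: F).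

Inductive two_tree : {set {set T}} -> Prop :=
| two_tree_edge a b : a != b -> two_tree [set [set a; b]]
| two_tree_add F a b z : two_tree F -> a != b -> [set a; b] \in F ->
    z \notin cover F -> two_tree (add_triangle F a b z).

Lemma cover1 E : cover [set E] = E.
Proof. by rewrite /cover big_set1. Qed.

Lemma mem_cover F E v : E \in F -> v \in E -> v \in cover F.
Proof. by move=> EF vE; apply/bigcupP; exists E. Qed.

Lemma cover_pair F a b : [set a; b] \in F -> (a \in cover F) * (b \in cover F).
Proof. by move=> abF; split; apply: mem_cover abF _; rewrite !inE eqxx ?orbT. Qed.

Lemma cover_add_triangle F a b z :
  [set a; b] \in F -> cover (add_triangle F a b z) = z |: cover F.
Proof.
move=> /cover_pair[aF bF]; apply/setP=> v; rewrite !inE; apply/bigcupP/idP.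
  move=> [E]; rewrite !inE => /or3P[/eqP->|/eqP->|EF]; rewrite ?inE.
  - by case/orP=> /eqP->; rewrite ?eqxx ?aF ?orbT.
  - by case/orP=> /eqP->; rewrite ?eqxx ?bF ?orbT.
  - by move=> vE; rewrite (mem_cover EF vE) orbT.
case/orP=> [/eqP->|/bigcupP[E EF vE]].
  by exists [set z; a]; rewrite !inE eqxx.
by exists E => //; rewrite !inE EF !orbT.
Qed.

Lemma notin_pair F z a : z \notin cover F -> [set z; a] \notin F.
Proof. by apply: contra => /cover_pair[]. Qed.

Lemma card_add_triangle_new F a b z : a != b -> [set a; b] \in F ->
  z \notin cover F ->
  #|add_triangle F a b z| = #|F| + 2 /\ #|cover (add_triangle F a b z)| = #|cover F| + 1.
Proof.
move=> nab abF zF; rewrite cover_add_triangle // cardsU1 zF; split; last by rewrite addnC.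
rewrite !cardsU1 in_setU1 negb_or !notin_pair // andbT.
suff -> : [set z; a] != [set z; b] by rewrite addnA addnC.
by apply: contra nab => /eqP/set2_eq[[_ ->]|[<- ->]].
Qed.

Lemma card_two_tree F : two_tree F -> #|F| + 3 = 2 * #|cover F|.
Proof.
elim=> [a b nab|F' a b z _ IH nab abF zF]; first by rewrite cover1 cards1 cards2 nab.
by have [-> ->] := card_add_triangle_new nab abF zF; lia.
Qed.

Lemma low_degree_new F a b z : z \notin cover F -> low_degree (add_triangle F a b z) z.
Proof.
move=> zF; exists a, b => E; rewrite !inE => /or3P[/eqP->|/eqP->|EF]; auto.
by move=> zE; rewrite (mem_cover EF zE) in zF.
Qed.

Lemma low_degree_add F a b z v : v != a -> v != b -> v != z ->
  low_degree F v -> low_degree (add_triangle F a b z) v.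
Proof.
move=> va vb vz [c [d cdP]]; exists c, d => E.
rewrite !inE => /or3P[/eqP->|/eqP->|/cdP//];
  by rewrite !inE (negPf vz) ?(negPf va) ?(negPf vb).
Qed.

Lemma two_tree_low_degree F : two_tree F -> exists v, low_degree F v.
Proof.
case=> [a b nab|F' a b z _ _ _ zF]; last by exists z; apply: low_degree_new.
by exists a, b, b => E; rewrite inE => /eqP->; left.
Qed.

(** The last vertex [z] serves unless it lies on the edge [bw]. In that case [b] and [w] are among
    [z], [p], [q], and induction on the edge [pq] gives a vertex avoiding all three. *)
Lemma two_tree_low_degree_off F b w : two_tree F -> [set b; w] \in F ->
  F = [set [set b; w]] \/
  exists v, [/\ v != b, v != w, v \in cover F & low_degree F v].
Proof.
move=> tF; elim: tF b w => [a c nac|F' p q z tF' IH npq pqF' zF'] b w.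
  by rewrite inE => /eqP->; left.
move=> bwF; right.
have coverF := cover_add_triangle z pqF'.
have [pF qF] := cover_pair pqF'.
have [zbw|nzbw] := boolP (z \in [set b; w]); last first.
  exists z; move: nzbw; rewrite coverF !inE eqxx negb_or => /andP[-> ->].
  by split=> //; apply: low_degree_new.
have nqp : q != p by rewrite eq_sym.
have bw_zpq : {subset [set b; w] <= [set z; p; q]}.
  move: bwF; rewrite !inE => /or3P[/eqP->|/eqP->|bwF].
  - by move=> v; rewrite !inE => /orP[]->; rewrite ?orbT.
  - by move=> v; rewrite !inE => /orP[]->; rewrite ?orbT.
  - by rewrite (mem_cover bwF zbw) in zF'.
have zp : p != z by apply: contraNneq zF' => <-.
have zq : q != z by apply: contraNneq zF' => <-.
case: (IH _ _ pqF') => [F'E|[v [vp vq vF vlow]]].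
(* Here [F] is the triangle on [z], [p], [q], and [u] is its vertex opposite to the edge [bw]. *)
- have [u [upq ub uw]] : exists u, [/\ u \in [set p; q], u != b & u != w].
    move: bwF; rewrite !inE => /or3P[/eqP/set2_eq[]|/eqP/set2_eq[]|bwF].
    + by case=> -> ->; exists q; rewrite !inE eqxx orbT nqp zq.
    + by case=> -> ->; exists q; rewrite !inE eqxx orbT nqp zq.
    + by case=> -> ->; exists p; rewrite !inE eqxx npq zp.
    + by case=> -> ->; exists p; rewrite !inE eqxx npq zp.
    + by rewrite (mem_cover bwF zbw) in zF'.
  exists u; split=> //.
    by rewrite coverF; move: upq; rewrite !inE => /orP[]/eqP->; rewrite ?pF ?qF orbT.
  have uz : u != z by move: upq; rewrite !inE => /orP[]/eqP->.
  move: upq; rewrite !inE => /orP[]/eqP uE; subst u.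
    exists z, q => E; rewrite F'E !inE => /or3P[]/eqP->.
    + by rewrite setUC; left.
    + by rewrite !inE (negPf uz) (negPf npq).
    + by right.
  exists z, p => E; rewrite F'E !inE => /or3P[]/eqP->.
  + by rewrite !inE (negPf uz) (negPf nqp).
  + by rewrite setUC; left.
  + by rewrite setUC; right.
have vz : v != z by apply: contraNneq zF' => <-.
exists v; split.
- by apply: contraTneq vz => vb; have := bw_zpq b; rewrite -vb !inE eqxx (negPf vp) (negPf vq) !orbF => /(_ isT)->.
- by apply: contraTneq vz => vb; have := bw_zpq w; rewrite -vb !inE eqxx orbT (negPf vp) (negPf vq) !orbF => /(_ isT)->.
- by rewrite coverF inE vF orbT.
- exact: low_degree_add.
Qed.

(** * Paths and fans *)

Fixpoint path_edges s : {set {set T}} :=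
  if s is a :: s' then
    if s' is b :: _ then [set a; b] |: path_edges s' else set0
  else set0.

Lemma path_edges_rcons s a b :
  path_edges (rcons (rcons s a) b) = [set a; b] |: path_edges (rcons s a).
Proof.
elim: s => [|c s IH] //=.
move: IH; case: s => [|d s] /= IH; first by rewrite setUCA.
by rewrite IH setUCA.
Qed.

Lemma path_edges_rev s : path_edges (rev s) = path_edges s.
Proof.
elim: s => [|a [|b s] IH] //.
by rewrite rev_cons [in rev (b :: s)]rev_cons path_edges_rcons -rev_cons IH setUC /= [[set b; a]]setUC setUC.
Qed.

Lemma mem_path_edges x0 s E : reflect
  (exists2 i, i.+1 < size s & E = [set nth x0 s i; nth x0 s i.+1]) (E \in path_edges s).
Proof.
apply: (iffP idP); elim: s => [|a [|b s] IH] //=.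
- by rewrite inE.
- by rewrite inE.
- rewrite !inE => /orP[/eqP->|/IH[i lti ->]]; first by exists 0.
  by exists i.+1.
- by case.
- by case.
- case=> -[|i] lti EE; rewrite in_setU1; first by rewrite EE eqxx.
  by apply/orP; right; apply: IH; exists i.
Qed.

Lemma last_rev x s : last x (rev s) = head x s.
Proof. by case: s => // a s; rewrite rev_cons last_rcons. Qed.

(** The hub is [x] and the path [s] runs from [b] to [w]. The condition on [cover F] excludes an
    empty path; a path of one vertex is allowed and gives a single edge. *)
Definition is_fan F x b w :=
  exists s, [/\ uniq (x :: s), head x s = b, last x s = w, cover F = [set v in x :: s]
    & F = [set [set x; v] | v in s] :|: path_edges s].

Lemma is_fan_sym F x b w : is_fan F x b w -> is_fan F x w b.
Proof.
case=> s [us hb lw cF FE]; exists (rev s); split.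
- by rewrite /= mem_rev rev_uniq.
- by rewrite -last_rev revK.
- by rewrite last_rev.
- by rewrite cF; apply/setP=> v; rewrite !inE mem_rev.
- rewrite path_edges_rev FE; congr (_ :|: _).
  by apply/setP=> E; apply/imsetP/imsetP=> -[v vs ->]; exists v; rewrite // ?mem_rev // -mem_rev.
Qed.

Lemma fan_edge F x b w : F = [set [set x; b]] -> x != b -> is_fan F x b b.
Proof.
move=> -> nxb; exists [:: b]; split=> //=.
- by rewrite inE nxb.
- by rewrite cover1; apply/setP=> v; rewrite !inE.
- by apply/setP=> E; rewrite !inE orbF; apply/eqP/imsetP=> [->|[v]]; first (by exists b; rewrite ?inE); rewrite inE => /eqP->.
Qed.

Lemma two_tree_neq F a b : two_tree F -> [set a; b] \in F -> a != b.
Proof.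
move=> tF; elim: tF a b => [c d ncd|F' p q z tF' IH npq pqF' zF'] a b.
  by rewrite inE => /eqP/set2_eq[[-> ->]|[-> ->]] //; rewrite eq_sym.
have [pF qF] := cover_pair pqF'.
have zp : z != p by apply: contraNneq zF' => ->.
have zq : z != q by apply: contraNneq zF' => ->.
rewrite !inE => /or3P[/eqP/set2_eq|/eqP/set2_eq|/IH //].
  by case=> -[-> ->] //; rewrite eq_sym.
by case=> -[-> ->] //; rewrite eq_sym.
Qed.

(** A vertex attached to the hub and to the end [y] of the path prolongs the path beyond [y]. *)
Lemma is_fan_add F x b y w : [set x; y] \in F -> b \notin cover F -> is_fan F x y w ->
  is_fan (add_triangle F x y b) x b w.
Proof.
move=> xyF bF [s [us hy lw cF FE]].
have sE : s = y :: behead s.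
  case: s us hy lw cF FE => [|c s] //= us <- //.
  by move=> _ _ FE; move: xyF; rewrite FE !inE orbF => /imsetP[].
move: bF; rewrite cF !inE negb_or => /andP[bx bs].
exists (b :: s); split=> //.
- by rewrite /= !inE negb_or eq_sym bx bs.
- by move: lw; rewrite /= sE.
- rewrite cover_add_triangle // cF; apply/setP=> v; rewrite !inE; by case: (v == b); rewrite ?orbT.
- have -> : path_edges (b :: s) = [set b; y] |: path_edges s by rewrite sE.
  rewrite /add_triangle {1}FE.
  apply/setP=> E; rewrite !inE.
  have -> : (E \in [set [set x; v] | v in b :: s]) = (E == [set b; x]) || (E \in [set [set x; v] | v in s]).
    apply/imsetP/orP=> [[v]|[/eqP->|/imsetP[v vs ->]]].
    + rewrite inE => /orP[/eqP->->|vs ->]; first by rewrite setUC; left.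
      by right; apply: imset_f.
    + by exists b; rewrite ?mem_head // setUC.
    + by exists v; rewrite // inE vs orbT.
  by rewrite -!orbA; congr (_ || _); rewrite orbCA.
Qed.

Lemma add_triangleC F a b z : add_triangle F a b z = add_triangle F b a z.
Proof. by rewrite /add_triangle setUCA. Qed.

(* Peeling off the last vertex [z] of the construction: it has degree two, so it
   is an end of the fan, unless the fan is a single triangle. *)
Lemma two_tree_fan F x b w : two_tree F ->
  [set b; x] \in F -> [set w; x] \in F ->
  (forall v, v \in cover F -> low_degree F v -> v \in [set b; w; x]) ->
  is_fan F x b w.
Proof.
move=> tF; elim: tF x b w => [p q npq|F' p q z tF' IH npq pqF' zF'] x b w bxF wxF lowF.
  have tF0 := two_tree_edge npq.
  have xw := two_tree_neq tF0 wxF; have := bxF; have := wxF.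
  rewrite !inE => /eqP wx /eqP bx; have bw : b = w.
    by move: wx; rewrite -bx => /set2_eq[[->]//|[wx' _]]; rewrite wx' eqxx in xw.
  rewrite -bw -bx; apply: fan_edge => //; first by rewrite setUC.
  by rewrite eq_sym bw.
have tF0 := two_tree_add tF' npq pqF' zF'.
have lowF' v : v \in cover F' -> v != p -> v != q -> low_degree F' v -> v \in [set b; w; x].
  move=> vF vp vq lv; apply: lowF; first by rewrite cover_add_triangle // inE vF orbT.
  by apply: low_degree_add lv => //; apply: contraNneq zF' => <-.
have lowz : z \in [set b; w; x].
  apply: lowF; last exact: low_degree_new.
  by rewrite cover_add_triangle // !inE eqxx.
have bwx : b = w \/ b != w by case: eqVneq; auto.
case: bwx => [bw|nbw].
  (* When the ends coincide, all vertices of low degree lie on the edge [bx], which forces a single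
     edge. *)
  rewrite -bw in wxF lowF *; have [] := two_tree_low_degree_off tF0 bxF.
    by rewrite setUC => FE; apply: fan_edge => //; rewrite eq_sym (two_tree_neq tF0 bxF).
  case=> v [vb vx /lowF vF /vF].
  by rewrite !inE (negPf vb) (negPf vx).
have old c d : z != c -> z != d -> [set c; d] \in add_triangle F' p q z -> [set c; d] \in F'.
  by move=> zc zd; rewrite !inE => /or3P[/eqP/set2_eq|/eqP/set2_eq|//];
     case=> -[??]; subst; rewrite eqxx in zc zd.
have nbr c : [set z; c] \in add_triangle F' p q z -> c = p \/ c = q.
  rewrite !inE => /or3P[/eqP/set2_eq|/eqP/set2_eq|zcF].
  - by case=> -[??]; subst; auto.
  - by case=> -[??]; subst; auto.
  - by have [zF _] := cover_pair zcF; rewrite zF in zF'.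
(* the case where [z] is an end of the path; the other end is symmetric *)
have fan_z u : z != u -> z != x -> [set z; x] \in add_triangle F' p q z ->
    [set u; x] \in add_triangle F' p q z -> {subset [set b; w] <= [set z; u]} ->
    is_fan (add_triangle F' p q z) x z u.
  move=> zu zx zxF uxF bw_zu; have uxF' := old _ _ zu zx uxF.
  (* [y] is the neighbour of [z] other than [x]. By induction [F'] is a fan from [y] to [u], and [z]
     goes in front of [y]. *)
  have [y [xyF' addE xy_pq]] : exists y, [/\ [set x; y] \in F',
      add_triangle F' p q z = add_triangle F' x y z & forall v, v \notin [set x; y] -> v != p /\ v != q].
    case: (nbr _ zxF) => ->.
      by exists q; split=> // v; rewrite !inE negb_or => /andP[].
    exists p; rewrite setUC add_triangleC; split=> // v.
    by rewrite !inE negb_or => /andP[].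
  rewrite addE; apply: is_fan_add => //; apply: IH => //; first by rewrite setUC.
  move=> v vF lv; have [|vxy] := boolP (v \in [set x; y]).
    by rewrite !inE => /orP[]->; rewrite ?orbT.
  have [vp vq] := xy_pq _ vxy.
  have zv : v != z by apply: contraNneq zF' => <-.
  have := lowF' _ vF vp vq lv; rewrite in_setU => /orP[/bw_zu|].
    by rewrite !inE (negPf zv) => /= ->; rewrite orbT.
  by rewrite !inE => ->; rewrite orbT.
move: lowz; rewrite !inE -orbA => /or3P[]/eqP zE; subst z.
- by apply: fan_z => //; apply: two_tree_neq bxF.
- apply: is_fan_sym; apply: fan_z => //; first by rewrite eq_sym.
    by apply: two_tree_neq wxF.
  by move=> v; rewrite setUC.
(* Now the hub itself was added last. A vertex of low degree in [F'] off the edge [pq] would have to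
   be the hub, which [F'] does not cover; so [F'] is one edge and the fan is a triangle. *)
have fan_triangle : F' = [set [set p; q]] -> is_fan (add_triangle F' p q x) x p q.
  move=> F'E; have [xp xq] : x != p /\ x != q.
    by have [pF qF] := cover_pair pqF'; split; apply: contraNneq zF' => ->.
  exists [:: p; q]; split=> //=.
  - by rewrite !inE negb_or xp xq npq.
  - by rewrite cover_add_triangle // F'E cover1; apply/setP=> v; rewrite !inE.
  - rewrite /add_triangle F'E setUA; congr (_ :|: _); last by rewrite setU0.
    apply/setP=> E; rewrite !inE; apply/orP/imsetP.
      by case=> /eqP->; [exists p|exists q]; rewrite ?inE ?eqxx ?orbT.
    by case=> v; rewrite !inE => /orP[]/eqP-> ->; rewrite eqxx; auto.
have [bwpq fan_bw] : [set p; q] = [set b; w] /\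
    (is_fan (add_triangle F' p q x) x p q -> is_fan (add_triangle F' p q x) x b w).
  have bpq : b = p \/ b = q by apply: nbr; rewrite setUC.
  have wpq : w = p \/ w = q by apply: nbr; rewrite setUC.
  case: bpq wpq nbw => -> [->|->]; rewrite ?eqxx // => _.
  by split; [rewrite setUC|apply: is_fan_sym].
have [F'E|[v [vp vq vF lv]]] := two_tree_low_degree_off tF' pqF'.
  exact/fan_bw/fan_triangle.
have := lowF' _ vF vp vq lv; rewrite -bwpq !inE (negPf vp) (negPf vq) /= => /eqP vx.
by rewrite -vx vF in zF'.
Qed.

End TwoTrees.

(** * Growing edge sets by triangles *)

Section TriangleClasses.
Variable T : finType.
Implicit Types (a b c v w x y z : T) (E : {set T}) (F G : {set {set T}}).

Definition chorded_two_tree F := exists F' u w x,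
  [/\ two_tree F', u != w, [set u; x] \in F', [set w; x] \in F' & F = [set u; w] |: F'].

(** On $m$ covered vertices the cases are $2m-3$ edges, $2m-2$ edges, and at least $2m-1$ edges.
    Structure is recorded only in the first two. *)
Definition growth_cases F :=
  [\/ two_tree F,
      #|F| + 2 = 2 * #|cover F| /\ ((exists v, low_degree F v) \/ chorded_two_tree F)
    | 2 * #|cover F| <= #|F| + 1].

Lemma growth_cases_card F : growth_cases F -> 2 * #|cover F| <= #|F| + 3.
Proof. by case=> [/card_two_tree|[]|]; lia. Qed.

(** A new [z] brings one vertex and two edges, so the excess over $2m-3$ is unchanged and [z] has
    low degree. An old [z] raises the excess by one for each of [za], [zb] that is new. *)
Lemma growth_cases_add F a b z : growth_cases F -> [set a; b] \in F -> a != b ->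
  z != a -> z != b -> growth_cases (add_triangle F a b z).
Proof.
move=> dF abF nab za zb; have [zF|zF] := boolP (z \in cover F); last first.
  have [cardF cardV] := card_add_triangle_new nab abF zF.
  case: dF => [tF|[cF _]|cF].
  - by constructor 1; apply: two_tree_add.
  - constructor 2; rewrite cardF cardV; split; first by lia.
    by left; exists z; apply: low_degree_new.
  - by constructor 3; rewrite cardF cardV; lia.
have cover_same : cover (add_triangle F a b z) = cover F.
  by rewrite cover_add_triangle //; apply/setUidPr; rewrite sub1set.
have U1 E : E \in F -> E |: F = F by move=> EF; apply/setUidPr; rewrite sub1set.
(* The triangle [c], [d], [z] lacks only [zd]. Over a 2-tree this edge is the chord, with [c] as the
   common neighbour of its ends. *)
have one_new c d : z != d -> [set c; d] \in F -> [set z; c] \in F -> [set z; d] \notin F ->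
    cover ([set z; d] |: F) = cover F -> growth_cases ([set z; d] |: F).
  move=> nzd cdF zcF zdF coverE.
  have cardE : #|[set z; d] |: F| = #|F| + 1 by rewrite cardsU1 zdF addnC.
  case: dF => [tF|[cF _]|cF].
  - constructor 2; rewrite cardE coverE; split; first by have := card_two_tree tF; lia.
    by right; exists F, z, d, c; split=> //; rewrite setUC.
  - by constructor 3; rewrite cardE coverE; lia.
  - by constructor 3; rewrite cardE coverE; lia.
have [zaF|zaF] := boolP ([set z; a] \in F); have [zbF|zbF] := boolP ([set z; b] \in F).
- by rewrite /add_triangle !U1.
- have addE : add_triangle F a b z = [set z; b] |: F by rewrite /add_triangle setUCA U1.
  by rewrite addE in cover_same *; apply: one_new zb abF zaF zbF cover_same.
- have addE : add_triangle F a b z = [set z; a] |: F by rewrite /add_triangle U1.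
  rewrite addE in cover_same *; apply: one_new za _ zbF zaF cover_same; by rewrite setUC.
- have cardE : #|add_triangle F a b z| = #|F| + 2.
    rewrite !cardsU1 in_setU1 negb_or zaF zbF andbT.
    suff -> : [set z; a] != [set z; b] by rewrite addnA addnC.
    by apply: contra nab => /eqP/set2_eq[[_ ->]|[<- ->]].
  constructor 3; rewrite cover_same cardE.
  by case: dF => [/card_two_tree|[]|]; lia.
Qed.

(** * Triangle classes and the weighted count of their edges *)

Definition share_triangle G E E' := [exists a, exists b, exists z,
  [&& E == [set a; b], E' == [set z; a], [set a; b] \in G, [set z; a] \in G & [set z; b] \in G]].

Lemma share_triangleP G E E' : reflect
  (exists a b z, [/\ E = [set a; b], E' = [set z; a],
     [set a; b] \in G, [set z; a] \in G & [set z; b] \in G]) (share_triangle G E E').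
Proof.
apply: (iffP existsP) => [[a /existsP[b /existsP[z /and5P[/eqP-> /eqP-> ? ? ?]]]]|].
  by exists a, b, z.
case=> a [b [z [-> -> ? ? ?]]]; exists a; apply/existsP; exists b; apply/existsP; exists z.
by apply/and5P; rewrite !eqxx.
Qed.

Lemma share_triangle_sym G : symmetric (share_triangle G).
Proof.
suff sub E E' : share_triangle G E E' -> share_triangle G E' E.
  by move=> E E'; apply/idP/idP; apply: sub.
case/share_triangleP=> a [b [z [-> -> ab za zb]]]; apply/share_triangleP.
by exists a, z, b; split; rewrite // setUC.
Qed.

Definition triangle_class G E := [set E' in G | connect (share_triangle G) E E'].

Lemma triangle_class_refl G E : E \in G -> E \in triangle_class G E.
Proof. by move=> EG; rewrite inE EG connect0. Qed.

Lemma triangle_class_closed G E E1 E2 : E1 \in triangle_class G E ->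
  share_triangle G E1 E2 -> E2 \in triangle_class G E.
Proof.
rewrite !inE => /andP[_ EE1] E12; rewrite (connect_trans EE1 (connect1 E12)) andbT.
by case/share_triangleP: E12 => a [b [z [_ ->]]].
Qed.

Lemma closed_set_connect (U : finType) (r : rel U) (A : {set U}) (x y : U) :
  (forall u v : U, u \in A -> r u v -> v \in A) -> connect r x y -> x \in A -> y \in A.
Proof.
move=> clA /connectP[p rp ->] {y}; elim: p x rp => //= v p IH x /andP[xv vp] xA.
exact: IH vp (clA _ _ xA xv).
Qed.

Definition proper_pairs G := forall a b, [set a; b] \in G -> a != b.

Lemma growth_cases_triangle_class G a b : proper_pairs G -> [set a; b] \in G ->
  growth_cases (triangle_class G [set a; b]).
Proof.
set C := triangle_class G _ => Gpp abG.
(* Induction on a bound [k] for the number of edges of [C] still missing. If [F] is not closed under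
   sharing a triangle, the triangle that leads out of it is added. *)
have grow k F : #|C| - #|F| <= k -> [set a; b] \in F -> F \subset C -> growth_cases F -> growth_cases C.
  elim: k F => [|k IH] F leC abF FC dF.
    suff <- : F = C by [].
    by apply/eqP; rewrite eqEcard FC -subn_eq0 -leqn0.
  have [clF|] := boolP [forall E1, forall E2, (E1 \in F) && share_triangle G E1 E2 ==> (E2 \in F)].
    suff <- : F = C by [].
    apply/eqP; rewrite eqEsubset FC; apply/subsetP=> E; rewrite inE => /andP[_ abE].
    apply: closed_set_connect abE abF => E1 E2 E1F E12.
    by move/forallP/(_ E1)/forallP/(_ E2)/implyP: clF; apply; rewrite E1F.
  rewrite negb_forall => /existsP[E1]; rewrite negb_forall => /existsP[E2].
  rewrite negb_imply => /andP[/andP[E1F /share_triangleP[c [d [z [E1E E2E cdG zcG zdG]]]]] E2F].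
  subst E1 E2; have zcC : [set z; c] \in C.
    apply: triangle_class_closed (subsetP FC _ E1F) _.
    by apply/share_triangleP; exists c, d, z.
  have zdC : [set z; d] \in C.
    apply: triangle_class_closed (subsetP FC _ E1F) _.
    by apply/share_triangleP; exists d, c, z; split; rewrite // setUC.
  apply: IH (add_triangle F c d z) _ _ _ _; last by apply: growth_cases_add => //; exact: Gpp.
  - have : F \proper add_triangle F c d z.
      apply/properP; split; first by apply/subsetP=> E EF; rewrite !inE EF !orbT.
      by exists [set z; c]; rewrite // !inE eqxx.
    have : #|F| <= #|C| by apply: subset_leq_card.
    move=> leFC /proper_card; set f := #|F| in leC leFC *; set g := #|add_triangle _ _ _ _|.
    by move: leC leFC; move: f g #|C| => f g m; lia.
  - by rewrite !inE abF !orbT.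
  - by apply/subsetP=> E; rewrite in_setU1 in_setU1 => /or3P[/eqP->|/eqP->|/(subsetP FC)].
apply: (grow _ [set [set a; b]] (leqnn _)).
- by rewrite inE.
- by rewrite sub1set triangle_class_refl.
- by constructor 1; apply/two_tree_edge/Gpp.
Qed.

Definition triangle_classes G := equivalence_partition (connect (share_triangle G)) G.

Lemma triangle_classesP G : partition (triangle_classes G) G.
Proof.
apply: equivalence_partitionP => E1 E2 E3 _ _ _; split=> [|E12]; first exact: connect0.
exact: (same_connect (sym_connect_sym (@share_triangle_sym G))) E12 _.
Qed.

Lemma triangle_classes_class G C : C \in triangle_classes G ->
  exists2 E, E \in G & C = triangle_class G E.
Proof. by case/imsetP=> E EG ->; exists E. Qed.

Definition has_triangles G := forall a b, [set a; b] \in G ->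
  exists z, [set z; a] \in G /\ [set z; b] \in G.

Definition are_pairs G := forall E, E \in G -> exists a b, E = [set a; b].

(** A triangle through an edge lies wholly in the class of that edge. Hence a class with fewer than
    three shared vertices also has an unshared one. *)
Lemma card_cover_class G C : are_pairs G -> proper_pairs G -> has_triangles G ->
  C \in triangle_classes G -> 3 <= #|cover C|.
Proof.
move=> Gp Gpp Gt /triangle_classes_class[E EG ->].
have [a [b EE]] := Gp _ EG; subst E; have [z [zaG zbG]] := Gt _ _ EG.
have abC := triangle_class_refl EG.
have zaC : [set z; a] \in triangle_class G [set a; b].
  by apply: triangle_class_closed abC _; apply/share_triangleP; exists a, b, z.
have -> : 3 = #|[set z; a; b]|.
  by rewrite -setUA cardsU1 cards2 !inE negb_or !Gpp.
apply/subset_leq_card/subsetP=> v; have [zC aC] := cover_pair zaC; have [_ bC] := cover_pair abC.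
by rewrite !inE => /orP[/orP[]|]/eqP->.
Qed.

(* A vertex covered by at least two classes is charged one unit by each of them,
   any other vertex two units by its only class. *)
Lemma card_edges_shared G : cover G = setT ->
  (forall C, C \in triangle_classes G -> 2 * #|cover C| <= #|C| + 3) ->
  (forall C, C \in triangle_classes G -> 3 <=
    #|[set v in cover C | 1 < #|[set C' in triangle_classes G | v \in cover C']|]|) ->
  2 * #|T| <= #|G|.
Proof.
move=> covG le2 le3; set P := triangle_classes G.
have partP : partition P G := triangle_classesP G.
pose c v := #|[set C' in P | v \in cover C']|.
pose wt v := if 1 < c v then 1 else 2.
rewrite (card_partition partP).
have -> : 2 * #|T| = \sum_(v : T) 2 by rewrite sum_nat_const mulnC.
apply: (@leq_trans (\sum_(C in P) \sum_(v in cover C) wt v)); last first.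
  apply: leq_sum => C CP.
  (* The weight of a class is twice its number of vertices minus its number of shared vertices.
     Three shared vertices thus absorb the 3 in the bound on [#|C|]. *)
  have : \sum_(v in cover C) wt v + #|[set v in cover C | 1 < c v]| = 2 * #|cover C|.
    rewrite -sum1dep_card mulnC -sum_nat_const.
    rewrite [X in _ + X]big_mkcondr /= -big_split /=.
    by apply: eq_bigr => v _; rewrite /wt; case: ifP.
  move=> sumE; have := le2 _ CP; rewrite -sumE => leC; rewrite -(leq_add2r 3).
  by apply: leq_trans leC; rewrite leq_add2l le3.
(* Summed by vertices, [v] contributes [c v * wt v], which is at least 2 once [v] lies in some
   class. *)
rewrite (exchange_big_dep xpredT) //=; apply: leq_sum => v _.
rewrite sum_nat_const.
have -> : #|[pred C in P | v \in cover C]| = c v by rewrite /c cardsE; apply: eq_card => C; rewrite !inE.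
have : 0 < c v.
  have : v \in cover G by rewrite covG inE.
  case/bigcupP=> E EG vE; apply/card_gt0P.
  have EC : E \in cover P by rewrite (cover_partition partP).
  by case/bigcupP: EC => C CP EC; exists C; rewrite inE CP (mem_cover EC vE).
by rewrite /wt; case: ifP; lia.
Qed.

End TriangleClasses.

(** * Adjacency in the wheel *)

Section Wheel.

(** One orientation of each edge: spokes, consecutive rim vertices, and the edge closing the rim,
    where [m] is the last index. *)
Definition wheel_edge m i j :=
  [\/ i = 0 /\ 0 < j, 0 < i /\ j = i.+1 | i = 1 /\ j = m].

Lemma wheelP n (i j : 'I_n) : 3 < n ->
  reflect (wheel_edge n.-1 i j \/ wheel_edge n.-1 j i) (wheel n i j).
Proof.
move=> n3; set m := n.-1; have m3 : 2 < m by rewrite /m; lia.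
have lei (k : 'I_n) : k <= m by have := ltn_ord k; rewrite /m; lia.
(* Rim vertices are numbered from 1 but reduced modulo [m] from 0, so the only wrap is from [m] to
   1. *)
have succE (k l : 'I_n) : k != 0 :> nat -> l != 0 :> nat ->
    (k.-1.+1 %% m == l.-1) = (l == k.+1 :> nat) || (k == m :> nat) && (l == 1 :> nat).
  move=> k0 l0; rewrite prednK ?lt0n //; have := lei k; have := lei l.
  rewrite (leq_eqVlt k) => lel /orP[/eqP->|ltk].
    by rewrite modnn eqxx /=; apply/eqP/idP; lia.
  by rewrite modn_small //; apply/eqP/idP; lia.
rewrite /wheel -/m -(inj_eq val_inj) /=.
have := lei i; have := lei j.
case: (eqVneq (i : nat) 0) => [i0|i0]; case: (eqVneq (j : nat) 0) => [j0|j0] lej leI /=.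
- by apply: (iffP idP); rewrite /wheel_edge; [lia|case=> -[]; lia].
- rewrite i0 andbT; apply: (iffP idP) => _; [by left; constructor 1; lia|lia].
- rewrite j0 andbT; apply: (iffP idP) => _; [by right; constructor 1; lia|lia].
- rewrite !succE //; apply: (iffP idP).
  + move=> /andP[_ /orP[]/orP[/eqP|/andP[/eqP ? /eqP ?]]] *.
    * by left; constructor 2; lia.
    * by right; constructor 3; lia.
    * by right; constructor 2; lia.
    * by left; constructor 3; lia.
  + by case=> -[]; lia.
Qed.

End Wheel.

(** * Edge sets of 3-connected graphs, and recognition of the wheel *)

Section Graph.
Variables (T : finType) (e : rel T).
Hypotheses (e_sym : symmetric e) (e_irr : irreflexive e).
Implicit Types (a b u v w x y z : T) (E : {set T}) (s : seq T).

Definition edge_set := [set E : {set T} | [exists x, exists y, e x y && (E == [set x; y])]].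

Lemma mem_edge_set a b : ([set a; b] \in edge_set) = e a b.
Proof.
rewrite inE; apply/existsP/idP => [[x /existsP[y /andP[exy /eqP/set2_eq]]]|eab].
  by case=> -[-> ->] //; rewrite e_sym.
by exists a; apply/existsP; exists b; rewrite eab eqxx.
Qed.

Lemma edge_set_pairs : are_pairs edge_set.
Proof. by move=> E; rewrite inE => /existsP[x /existsP[y /andP[_ /eqP->]]]; exists x, y. Qed.

Lemma edge_set_proper : proper_pairs edge_set.
Proof. by move=> a b; rewrite mem_edge_set; apply: contraTneq => ->; rewrite e_irr. Qed.

Lemma edge_set_triangles : 2 < #|T| -> edge_pancyclic e -> has_triangles edge_set.
Proof.
move=> T3 e_pan a b; rewrite mem_edge_set => eab.
have [//|s /andP[/and4P[_ /eqP sz us cyc] ab]] := e_pan 3 _ a b eab.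
have {ab} [z [za zb]] : exists z, e z a /\ e z b.
  case: s sz us cyc ab => [|p [|q [|r []]]] //= _; rewrite !inE !negb_or !andbT.
  move=> /andP[/andP[pq pr] qr] /and3P[epq eqr erp].
  rewrite /edge_on_cycle; have np : next [:: p; q; r] p = q by rewrite /= eqxx.
  have nq : next [:: p; q; r] q = r by rewrite /= eq_sym (negPf pq) eqxx.
  have nr : next [:: p; q; r] r = p by rewrite /= eq_sym (negPf pr) eq_sym (negPf qr) eqxx.
  by case/orP=> /andP[]; rewrite !inE => /or3P[]/eqP->; rewrite ?np ?nq ?nr => /eqP <-;
    [exists r | exists p | exists q | exists r | exists p | exists q]; split; rewrite // e_sym.
by exists z; rewrite !mem_edge_set.
Qed.

(** Deleting the at most two neighbours of [v] would isolate it from a further vertex, which exists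
    since there are at least four. *)
Lemma no_low_degree v : k_connected e 3 -> ~ low_degree edge_set v.
Proof.
case=> T3 conn [a [b low]].
(* [a] or [b] may equal [v], which must survive the deletion. *)
pose S := [set a; b] :\ v.
have ltS : #|S| < 3.
  by rewrite (leq_ltn_trans (subset_leq_card (subsetDl _ _))) // cards2; case: eqP.
have [y yvab] : exists y, y \notin [set v; a; b].
  apply/existsP; rewrite -negb_forall; apply/negP => /forallP all_in.
  have : #|T| <= #|[set v; a; b]| by rewrite -cardsT; apply/subset_leq_card/subsetP.
  rewrite leqNgt (leq_trans _ T3) // ltnS -setUA cardsU1 cards2.
  by case: (_ \notin _); case: (_ != _).
move: yvab; rewrite !inE !negb_or -andbA => /and3P[yv ya yb].
have : y \in [set v]; last by rewrite inE (negPf yv).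
apply: closed_set_connect (conn S ltS v y _ _) (set11 v).
- move=> u u'; rewrite !inE => /eqP-> /and3P[evu _ uS].
  have vu : [set v; u'] \in edge_set by rewrite mem_edge_set.
  have : u' \in [set a; b].
    by case: (low _ vu (set21 _ _)) => /set2_eq[][] *; subst; rewrite ?set21 ?set22.
  move: uS; rewrite !inE negb_and negbK => /orP[//|/negPf->] //.
- by rewrite !inE eqxx.
- by rewrite !inE negb_and negb_or ya yb orbT.
Qed.

Lemma cover_edge_set : k_connected e 3 -> cover edge_set = setT.
Proof.
move=> conn; apply/setP=> v; rewrite in_setT; apply/negPn/negP => vG.
apply: (no_low_degree conn (v := v)); exists v, v => E EG vE.
by rewrite (mem_cover EG vE) in vG.
Qed.

(** Let [S] be the shared vertices of [C]. An edge at a vertex of [C] outside [S] belongs to [C], so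
    after deleting [S] no path leaves [C]. If [S] had fewer than three vertices, both [C] and [C']
    would keep a vertex, and connectivity would force [C = C']. *)
Lemma card_shared_vertices C C' : has_triangles edge_set -> k_connected e 3 ->
  C \in triangle_classes edge_set -> C' \in triangle_classes edge_set -> C != C' ->
  3 <= #|[set v in cover C | 1 < #|[set D in triangle_classes edge_set | v \in cover D]|]|.
Proof.
set P := triangle_classes _ => Gt [_ conn] CP C'P CC'; set S := [set v in _ | _].
rewrite leqNgt; apply/negP => ltS.
have exv D : D \in P -> exists2 v, v \in cover D & v \notin S.
  move=> DP; have card3 := card_cover_class edge_set_pairs edge_set_proper Gt DP.
  apply/subsetPn; apply: contraL ltS => /subset_leq_card leD.
  by rewrite -leqNgt (leq_trans card3).
have uniqD u D D' : u \in cover C -> u \notin S -> D \in P -> D' \in P ->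
    u \in cover D -> u \in cover D' -> D = D'.
  move=> uC; rewrite inE uC /= -leqNgt => /card_le1_eqP le1 DP D'P uD uD'.
  by apply: le1; rewrite inE ?DP ?D'P.
have [v vC vS] := exv _ CP; have [v' v'C' v'S] := exv _ C'P.
have : v' \in cover C :\: S.
  apply: closed_set_connect (conn S ltS v v' _ _) _; rewrite ?in_setC ?in_setD ?vS //.
  - move=> u u'; rewrite 2!in_setD => /andP[uS uC] /and3P[euu' _ u'S]; rewrite u'S /=.
    have uu'G : [set u; u'] \in edge_set by rewrite mem_edge_set.
    have : [set u; u'] \in cover P by rewrite (cover_partition (triangle_classesP _)).
    case/bigcupP=> D DP uu'D; have [uD u'D] := cover_pair uu'D.
    by rewrite (uniqD u C D).
rewrite in_setD => /andP[_ v'C].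
by move: CC'; rewrite (uniqD v' C C') ?eqxx.
Qed.

Lemma edge_set_growth_cases : has_triangles edge_set -> k_connected e 3 ->
  2 * #|T| <= #|edge_set| \/ growth_cases edge_set.
Proof.
move=> Gt conn; set G := edge_set; have covG := cover_edge_set conn.
have [v _] : exists v, v \in T by apply/card_gt0P; case: conn => T3 _; apply: leq_trans T3.
have : v \in cover G by rewrite covG.
case/bigcupP=> E0 E0G _; have [a [b E0E]] := edge_set_pairs E0G.
have mem_class E : E \in G -> triangle_class G E \in triangle_classes G.
  by move=> EG; apply: imset_f.
have := growth_cases_triangle_class edge_set_proper; rewrite -/G => dclass.
have [CG|[E EG EC]] : triangle_class G E0 = G \/ exists2 E, E \in G & E \notin triangle_class G E0.
  have [GC|/subsetPn[E EG EC]] := boolP (G \subset triangle_class G E0); last by right; exists E.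
  by left; apply/eqP; rewrite eqEsubset GC andbT; apply/subsetP=> E; rewrite inE => /andP[].
- by right; rewrite -CG E0E; apply: dclass; rewrite -E0E.
left; apply: card_edges_shared => // C CP.
  have [E1 E1G CE] := triangle_classes_class CP; have [c [d E1E]] := edge_set_pairs E1G.
  by rewrite CE E1E; apply/growth_cases_card/dclass; rewrite -E1E.
(* The class of [E0] differs from [C], or else the class of [E] does. *)
have [C' C'P CC'] : exists2 C', C' \in triangle_classes G & C != C'.
  have [->|CC0] := eqVneq C (triangle_class G E0); last by exists (triangle_class G E0); auto.
  exists (triangle_class G E); auto; apply: contraNneq EC => ->; exact: triangle_class_refl.
exact: card_shared_vertices C'P CC'.
Qed.

(** The list [t] is the labelling: the hub gets 0, the path gets 1 to [m], and [uw] becomes the rim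
    edge between 1 and [m]. *)
Lemma fan_isomorphic_wheel F x u w : 3 < #|T| -> is_fan F x u w -> cover F = setT ->
  edge_set = [set u; w] |: F -> isomorphic e (wheel #|T|).
Proof.
move=> T3 [s [us hu lw covF FE]] covT GE; set t := x :: s; set m := size s.
have tT v : v \in t by have := in_setT v; rewrite -covT covF inE.
have cardT : #|T| = m.+1.
  by rewrite -[m.+1]/(size t) -(card_uniqP us); apply: eq_card => v; rewrite tT.
have m3 : 2 < m by rewrite cardT in T3.
have nth_t_inj i j : i <= m -> j <= m -> nth x t i = nth x t j -> i = j.
  by move=> im jm /eqP; rewrite nth_uniq // => /eqP.
have t1 : nth x t 1 = u by rewrite /t /= nth0.
have tm : nth x t m = w by rewrite -lw (last_nth x).
have memG E : E \in edge_set <-> exists i j, [/\ i <= m, j <= m, wheel_edge m i j & E = [set nth x t i; nth x t j]].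
  rewrite GE FE; split.
    rewrite !inE => /or3P[/eqP->|/imsetP[v vs ->]|/(mem_path_edges x)[i im ->]].
    - exists 1, m; split; rewrite ?(ltnW (ltnW m3)) //; first by constructor 3.
      by rewrite t1 tm.
    - exists 0, (index v s).+1; rewrite index_mem vs; split=> //; first by constructor 1.
      by rewrite /t /= nth_index.
    - by exists i.+1, i.+2; split; rewrite // 1?ltnW //; constructor 2.
  case=> i [j [im jm ij ->]]; case: ij im jm => -[].
  - move=> -> j0 _ jm; rewrite in_setU1 in_setU; apply/or3P; constructor 2.
    by apply/imsetP; exists (nth x t j) => //; rewrite /t -(prednK j0) /= mem_nth // prednK.
  - move=> i0 -> _ im; rewrite in_setU1 in_setU; apply/or3P; constructor 3; apply/(mem_path_edges x).
    by case: i i0 im => // i _ im; exists i.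
  - move=> -> -> _ _; rewrite in_setU1 in_setU; apply/or3P; constructor 1.
    by rewrite t1 tm.
pose g (i : 'I_#|T|) := nth x t i.
have lei (i : 'I_#|T|) : i <= m by rewrite -ltnS -cardT.
have ginj : injective g by move=> i j /nth_t_inj ij; apply/val_inj/ij.
have [f fK gK] : bijective g by apply: inj_card_bij; rewrite // card_ord.
exists f; split; first by exists g.
move=> a b; rewrite -{2}[a]gK -{2}[b]gK -mem_edge_set; move: (f a) (f b) => i j.
apply/(wheelP _ _ T3)/idP; have -> : #|T|.-1 = m by rewrite cardT.
  case=> ij; apply/memG; first by exists i, j.
  by exists j, i; split=> //; rewrite setUC.
by case/memG=> k [l [km lm kl /set2_eq[]]] [/nth_t_inj-> // /nth_t_inj-> //]; auto.
Qed.

(** The edges are covered by [m] spokes and [m] rim edges. An upper bound suffices, as the lower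
    bound is proved for all graphs considered. *)
Lemma isomorphic_wheel_card : 3 < #|T| -> isomorphic e (wheel #|T|) -> #|edge_set| <= 2 * #|T| - 2.
Proof.
move=> T3 [f [[g fK gK] fE]]; set m := #|T|.-1.
have [x0 _] : exists v, v \in T by apply/card_gt0P; apply: leq_trans T3.
have cardT : m.+1 = #|T| by rewrite prednK // (leq_trans _ T3).
(* Vertices are indexed by plain naturals to ease the arithmetic; [x0] is a default for indices out
   of range. *)
pose t k := if insub k is Some i then g i else x0.
have tE v : t (f v) = v by rewrite /t valK fK.
pose spoke (k : 'I_m) := [set t 0; t k.+1].
pose rim (k : 'I_m) := [set t k.+1; t (k.+1 %% m).+1].
have sub a b : wheel_edge m (f a) (f b) -> [set a; b] \in [set spoke k | k in 'I_m] :|: [set rim k | k in 'I_m].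
  have ltfm v : f v <= m by rewrite -ltnS cardT.
  rewrite -{2}[a]tE -{2}[b]tE in_setU; have := ltfm a; have := ltfm b.
  move: (nat_of_ord (f a)) (nat_of_ord (f b)) => i j jm im ij.
  apply/orP; case: ij im jm => -[].
  - move=> -> j0 _ jm; left; have jm' : j.-1 < m by lia.
    by apply/imsetP; exists (Ordinal jm'); rewrite // /spoke /= prednK.
  - move=> i0 -> _ im; right; have im' : i.-1 < m by lia.
    by apply/imsetP; exists (Ordinal im'); rewrite // /rim /= prednK // modn_small.
  - move=> -> -> m1 _; right; have im' : m.-1 < m by lia.
    by apply/imsetP; exists (Ordinal im'); rewrite // /rim /= prednK // modnn setUC.
have : edge_set \subset [set spoke k | k in 'I_m] :|: [set rim k | k in 'I_m].
  apply/subsetP=> E EG; have [a [b EE]] := edge_set_pairs EG; move: EG; rewrite EE.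
  rewrite mem_edge_set -fE => /(wheelP _ _ T3)[/sub//|/sub]; by rewrite setUC.
move/subset_leq_card/leq_trans; apply.
apply: leq_trans (leq_card_setU _ _).1 _.
apply: leq_trans (leq_add (leq_imset_card _ _) (leq_imset_card _ _)) _.
by rewrite card_ord /m; lia.
Qed.

End Graph.

Theorem theorem3 (T : finType) (e : rel T)
  (e_sym : symmetric e) (e_irr : irreflexive e)
  (e_3conn : k_connected e 3) (e_pan : edge_pancyclic e) :
  2 * #|T| - 2 <= n_edges e /\
  (n_edges e = 2 * #|T| - 2 <-> isomorphic e (wheel #|T|)).
Proof.
have T3 : 3 < #|T| by case: e_3conn.
rewrite /n_edges -/(edge_set e).
have Gt := edge_set_triangles e_sym (ltnW T3) e_pan.
have covG := cover_edge_set e_sym e_3conn.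
have no_low v := no_low_degree e_sym (v := v) e_3conn.
have cardV : #|cover (edge_set e)| = #|T| by rewrite covG cardsT.
(* Minimum degree three rules out 2-trees and vertices of low degree. What remains is at least
   $2n-1$ edges, where both sides of the equivalence fail, or a chorded 2-tree. *)
have [le2|chorded] : 2 * #|T| <= #|edge_set e| + 1 \/
    #|edge_set e| + 2 = 2 * #|T| /\ chorded_two_tree (edge_set e).
  rewrite -cardV; case: (edge_set_growth_cases e_sym e_irr Gt e_3conn) => [|[]].
  - by rewrite cardV; lia.
  - by case/two_tree_low_degree=> v /no_low.
  - by case=> cardE [[v /no_low]|]; auto.
  - by left.
- split; first by lia.
  split=> [|/(isomorphic_wheel_card e_sym T3)]; lia.
case: chorded => cardE [F [u [w [x [tF nuw uxF wxF GE]]]]].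
split; first by lia.
split=> _; last by lia.
have covF : cover F = setT.
  rewrite -covG GE; apply/eqP; rewrite eqEsubset; apply/andP; split.
    by apply/subsetP=> v /bigcupP[E EF vE]; apply: mem_cover vE; rewrite inE EF orbT.
  have [uF _] := cover_pair uxF; have [wF _] := cover_pair wxF.
  apply/subsetP=> v /bigcupP[E]; rewrite in_setU1 => /orP[/eqP->|EF vE]; last exact: mem_cover EF vE.
  by rewrite !inE => /orP[]/eqP->.
apply: (@fan_isomorphic_wheel _ _ e_sym F x u w T3 _ covF GE).
apply: two_tree_fan => // v _ [a [b low]].
(* Off the chord [uw] a vertex has the same edges in [F] as in the graph, so it cannot have low
   degree. *)
have [|vuw] := boolP (v \in [set u; w; x]); first by [].
case: (no_low v); exists a, b => E; rewrite GE in_setU1 => /orP[/eqP->|/low//].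
by move: vuw; rewrite !inE !negb_or -andbA => /and3P[/negPf-> /negPf->].
Qed.
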